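(* Let $\alpha=\frac{1+\sqrt5}{2}$ and $\beta=\frac{1-\sqrt5}{2}$. For every integer $n\ge 4$, $$\sigma_1(W_n)=(n-1)\left[1+\frac{1}{\sqrt5}\left(\alpha^{n-3}-\beta^{n-3}\right)\right].$$
   Context: $W_n$ is the wheel graph of order $n$, i.e. the graph obtained from the cycle $C_{n-1}$ on $n-1\ge 3$ vertices by adding one new vertex adjacent to all vertices of the cycle. For a finite simple undirected graph $G$, $\sigma_1(G)$ denotes the number of $1$-nearly independent vertex subsets of $G$, i.e. the number of subsets $I$ of the vertex set $V(G)$ such that the subgraph of $G$ induced by $I$ has exactly one edge. *)

(* Defs.v *)
From HB Require Import structures.
From mathcomp Require Import all_boot all_order all_algebra.

Set Implicit Arguments.
Unset Strict Implicit.
Unset Printing Implicit Defensive.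

Record sgraph := SGraph {
  vertex :> finType;
  adj : rel vertex;
  adj_sym : symmetric adj;
  adj_irr : irreflexive adj }.

Definition edges (G : sgraph) : {set {set G}} :=
  [set [set p.1; p.2] | p : G * G & adj p.1 p.2].

Section Induced.
Variables (G : sgraph) (I : {set G}).

Definition induced_adj : rel {x : G | x \in I} :=
  fun x y => adj (val x) (val y).

Fact induced_adj_sym : symmetric induced_adj.
Proof. by move=> x y; rewrite /induced_adj adj_sym. Qed.

Fact induced_adj_irr : irreflexive induced_adj.
Proof. by move=> x; rewrite /induced_adj adj_irr. Qed.

Definition induced : sgraph := SGraph induced_adj_sym induced_adj_irr.
End Induced.

Definition sigma1 (G : sgraph) : nat :=
  #|[set I : {set G} | #|edges (induced I)| == 1]|.

Section Cycle.
Variable m : nat.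

(* [ordS] is the successor modulo [m], so for m >= 3 this is the cycle C_m;
   [x != y] only matters for m = 1, where [ordS] has a fixed point. *)
Definition cycle_adj : rel 'I_m :=
  fun x y => (x != y) && ((ordS x == y) || (ordS y == x)).

Fact cycle_adj_sym : symmetric cycle_adj.
Proof. by move=> x y; rewrite /cycle_adj eq_sym orbC. Qed.

Fact cycle_adj_irr : irreflexive cycle_adj.
Proof. by move=> x; rewrite /cycle_adj eqxx. Qed.

Definition cycle_graph : sgraph := SGraph cycle_adj_sym cycle_adj_irr.
End Cycle.

(* [cone G] adds to [G] one new vertex, [None], adjacent to all vertices. *)
Section Cone.
Variable G : sgraph.

Definition cone_adj : rel (option G) :=
  fun x y => match x, y with
             | Some u, Some v => adj u v
             | None, None => false
             | _, _ => true
             end.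

Fact cone_adj_sym : symmetric cone_adj.
Proof. by move=> [x|] [y|] //=; rewrite adj_sym. Qed.

Fact cone_adj_irr : irreflexive cone_adj.
Proof. by move=> [x|] //=; rewrite adj_irr. Qed.

Definition cone : sgraph := SGraph cone_adj_sym cone_adj_irr.
End Cone.

(* The index [n] is the order of the wheel; it is meant for n >= 4. *)
Definition wheel (n : nat) : sgraph := cone (cycle_graph n.-1).

(* Main.v *)
Require Import Defs.
From mathcomp Require Import all_boot all_order all_algebra.
From mathcomp Require Import zify ring.

Import GRing.Theory Num.Theory.

Set Implicit Arguments.
Unset Strict Implicit.
Unset Printing Implicit Defensive.

(** The hub together with one rim vertex induces one edge, and a set containing
    the hub and a different number of rim vertices never does; so
    [sigma1 (wheel n)] is [n - 1] plus [sigma1] of the rim cycle.  In a cycle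
    of length [m >= 3] the induced edges of [I] correspond to the [x] with [x]
    and [ordS x] in [I].  Rotation makes every position of the single edge
    equally likely; placing it at the wrap-around pair turns [I] into a 0-1 word
    that starts and ends with 1 and has no two consecutive 1s, and such words
    are counted by Fibonacci numbers. *)

(** * Edges of an induced subgraph, seen in the ambient graph *)

Definition edges_in (G : sgraph) (I : {set G}) : {set {set G}} :=
  [set e in edges G | e \subset I].

Lemma edgesP (G : sgraph) (e : {set G}) :
  reflect (exists x y, adj x y /\ e = [set x; y]) (e \in edges G).
Proof.
apply: (iffP imsetP) => [[[x y]]|[x [y [xy ->]]]].
  by rewrite inE /= => xy ->; exists x, y.
by exists (x, y); rewrite ?inE.
Qed.

Lemma edges_inP (G : sgraph) (I e : {set G}) :
  reflect (exists x y, [/\ adj x y, x \in I, y \in I & e = [set x; y]])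
    (e \in edges_in I).
Proof.
rewrite inE; apply: (iffP andP) => [[/edgesP[x [y [xy ->]]]]|[x [y [xy xI yI ->]]]].
  by rewrite subUset !sub1set => /andP[xI yI]; exists x, y.
by split; [apply/edgesP; exists x, y | rewrite subUset !sub1set xI].
Qed.

(** Taking images under [val] is injective on sets, so the subtype of vertices can be left
    behind. *)
Lemma card_edges_induced (G : sgraph) (I : {set G}) :
  #|edges (induced I)| = #|edges_in I|.
Proof.
rewrite -(card_imset _ (imset_inj (@val_inj _ _ {x : G | x \in I}))).
apply: eq_card => e; apply/imsetP/edges_inP.
  move=> [f /edgesP[x [y [xy ->]]] ->]; exists (val x), (val y).
  by split; rewrite ?(valP x) ?(valP y) // imsetU !imset_set1.
move=> [x [y [xy xI yI ->]]].
exists [set (Sub x xI : induced I); (Sub y yI : induced I)].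
  by apply/edgesP; exists (Sub x xI : induced I), (Sub y yI : induced I).
by rewrite imsetU !imset_set1.
Qed.

Lemma sigma1E (G : sgraph) : sigma1 G = #|[set I : {set G} | #|edges_in I| == 1]|.
Proof. by apply: eq_card => I; rewrite !inE card_edges_induced. Qed.

Lemma edges_in_small (G : sgraph) (I : {set G}) : #|I| <= 1 -> edges_in I = set0.
Proof.
move=> I1; apply/setP => e; rewrite in_set0; apply/negP => /edges_inP[x [y [xy xI yI _]]].
by move: xy; rewrite (card_le1_eqP I1 x y xI yI) adj_irr.
Qed.

(** * Induced edges in a cone *)

Section Cone.
Variable G : sgraph.

Let SomeS (J : {set G}) : {set cone G} := (Some : G -> cone G) @: J.

Let SomeS_inj : injective SomeS.
Proof. by apply: imset_inj => x y []. Qed.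

Let mem_SomeS J (x : G) : (Some x \in SomeS J) = (x \in J).
Proof. by rewrite mem_imset // => ? ? []. Qed.

Let None_SomeS J : (None \in SomeS J) = false.
Proof. by apply/imsetP => -[]. Qed.

Lemma edges_in_cone_base (J : {set G}) :
  #|edges_in (SomeS J)| = #|edges_in J|.
Proof.
rewrite -(card_imset _ SomeS_inj); apply: eq_card => e.
apply/edges_inP/imsetP.
  move=> [u [v [uv /imsetP[x xJ Eu] /imsetP[y yJ Ev] ->]]]; subst u v.
  exists [set x; y]; last by rewrite /SomeS imsetU !imset_set1.
  by apply/edges_inP; exists x, y.
move=> [f /edges_inP[x [y [xy xJ yJ ->]]] ->]; exists (Some x), (Some y).
by split; rewrite ?imset_f // /SomeS imsetU !imset_set1.
Qed.

Lemma edges_in_cone_apex (J : {set G}) :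
  #|edges_in ((None : cone G) |: SomeS J)| = #|J| + #|edges_in J|.
Proof.
pose spoke (x : G) : {set cone G} := [set None; Some x].
have spoke_inj : injective spoke.
  move=> x y /setP/(_ (Some x)); rewrite !inE eqxx /=.
  by move/esym/eqP => [].
rewrite -edges_in_cone_base -(card_imset _ spoke_inj) -cardsUI.
(* Spokes contain the hub and rim edges avoid it, so the two kinds of edges can be counted
   separately. *)
have -> : (spoke @: J) :&: edges_in (SomeS J) = set0.
  apply/setP => e; rewrite !inE; apply/negP => /and3P[/imsetP[x _ ->] _].
  by rewrite subUset sub1set => /andP[/imsetP[]].
rewrite cards0 addn0; apply: eq_card => e; rewrite in_setU.
apply/edges_inP/orP.
  move=> [[x|] [[y|] [xy + + ->]]]; rewrite !in_setU1 ?mem_SomeS ?None_SomeS //= => xJ yJ.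
  - by right; apply/(@edges_inP (cone G)); exists (Some x), (Some y); rewrite !mem_SomeS.
  - by left; apply/imsetP; exists x; rewrite // /spoke setUC.
  - by left; apply/imsetP; exists y.
move=> [/imsetP[x xJ ->]|/edges_inP[x [y [xy xJ yJ ->]]]].
  by exists None, (Some x); rewrite !inE ?eqxx imset_f.
by exists x, y; split=> //; rewrite inE ?xJ ?yJ orbT.
Qed.

Lemma sigma1_cone : sigma1 (cone G) = #|G| + sigma1 G.
Proof.
pose spoke (x : G) : {set cone G} := (None : cone G) |: SomeS [set x].
have spoke_inj : injective spoke.
  move=> x y /setP/(_ (Some x)); rewrite !inE /SomeS !imset_set1 !inE eqxx /=.
  by move/esym/eqP => [].
rewrite !sigma1E -(card_imset _ SomeS_inj).
rewrite -cardsT -(card_imset _ spoke_inj) -cardsUI.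
set A := spoke @: _; set B := SomeS @: _.
have -> : A :&: B = set0.
  apply/setP => I; rewrite !inE; apply/negP => /andP[/imsetP[x _ ->]].
  move=> /imsetP[J _ /setP/(_ None)]; rewrite !inE eqxx /=.
  by move/esym/imsetP => [].
rewrite cards0 addn0; apply: eq_card => I; rewrite !inE.
apply/idP/orP; last first.
  move=> [/imsetP[x _ ->]|/imsetP[J]].
    by rewrite edges_in_cone_apex cards1 edges_in_small ?cards1 ?cards0.
  by rewrite inE => J1 ->; rewrite edges_in_cone_base.
pose J : {set G} := [set x | Some x \in I].
have memJ x : (Some x \in SomeS J) = (Some x \in I) by rewrite mem_SomeS inE.
have [NI|NI] := boolP (None \in I).
  have -> : I = None |: SomeS J.
    by apply/setP => -[x|]; rewrite in_setU1 ?memJ.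
  rewrite edges_in_cone_apex => J1; left; apply/imsetP.
  (* The spokes alone number [#|J|], so [#|J| <= 1]; then there is no rim edge and the single edge
     must be a spoke. *)
  have /cards1P[x ->] : #|J| == 1.
    have [/edges_in_small E|] := leqP #|J| 1; last by lia.
    by rewrite E cards0 addn0 in J1.
  by exists x.
have -> : I = SomeS J.
  by apply/setP => -[x|]; rewrite ?memJ // None_SomeS (negPf NI).
by rewrite edges_in_cone_base => J1; right; apply/imsetP; exists J; rewrite ?inE.
Qed.

End Cone.

(** * Arcs of a cycle and rotation *)

Section Cycle.
Variable m : nat.
Implicit Types I : {set 'I_m.+3}.

(** Each rim edge is named by its tail in the [ordS] orientation, which makes rotation act on edges
    as on vertices. *)
Definition arcs_in I := [set x in I | ordS x \in I].

Lemma ordS_neq (x : 'I_m.+3) : (ordS x == x) = false.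
Proof.
apply/negP => /eqP/(congr1 val) /=; have := ltn_ord x => xm.
have [l|l] := ltnP x.+1 m.+3; first by rewrite modn_small //; lia.
have -> : x.+1 = m.+3 by lia.
rewrite modnn; lia.
Qed.

(** Length at least 3 matters here: in length 2 the arcs from [x] and from [ordS x] would be the
    same edge. *)
Lemma ordSS_neq (x : 'I_m.+3) : ordS (ordS x) <> x.
Proof.
move=> /(congr1 val) /=; rewrite -addn1 modnDml addn1; have := ltn_ord x => xm.
have [l|l] := ltnP x.+2 m.+3; first by rewrite modn_small //; lia.
have -> : x.+2 = (x.+2 - m.+3) + m.+3 by lia.
rewrite modnDr modn_small; lia.
Qed.

Lemma card_edges_in_cycle I :
  #|edges_in (I : {set cycle_graph m.+3})| = #|arcs_in I|.
Proof.
pose arc (x : 'I_m.+3) : {set cycle_graph m.+3} := [set x; ordS x].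
have arc_inj : injective arc.
  move=> x y /setP E; have := E x; have := E (ordS x).
  rewrite !inE !eqxx orbT /=; case: (x =P y) => //= _ + /esym/eqP Exy.
  rewrite Exy (inj_eq (@ordS_inj _)) => /esym/orP[/eqP/ordSS_neq//|].
  by rewrite ordS_neq.
rewrite -(card_imset _ arc_inj); apply: eq_card => e.
apply/edges_inP/imsetP.
  move=> [x [y [/andP[_ /orP[]/eqP<-] xI yI ->]]].
    by exists x; rewrite // inE xI.
  by exists y; rewrite ?inE ?yI // /arc setUC.
move=> [x]; rewrite inE => /andP[xI SxI ->]; exists x, (ordS x); split=> //.
by rewrite /= /cycle_adj eq_sym ordS_neq eqxx.
Qed.

Lemma arcs_in_rot I : arcs_in (@ordS _ @: I) = @ordS _ @: arcs_in I.
Proof.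
apply/setP => x; rewrite -(ord_predK x) !inE !mem_imset ?inE //; exact: ordS_inj.
Qed.

(** Rotating [I] by [ordS] is a bijection on subsets, undone by [ord_pred], and it shifts the arcs
    along. *)
Lemma card_arc_rot (x : 'I_m.+3) :
  #|[set I | arcs_in I == [set ordS x]]| = #|[set I | arcs_in I == [set x]]|.
Proof.
have Sinj := imset_inj (@ordS_inj m.+3).
rewrite -[RHS](card_imset _ Sinj).
apply: eq_card => I; apply/idP/imsetP => [|[J]]; rewrite !inE.
  move=> /eqP E; exists (@ord_pred _ @: I).
    rewrite inE -(inj_eq Sinj) -arcs_in_rot -imset_comp.
    by rewrite (eq_imset _ (@ord_predK _)) imset_id E imset_set1.
  by rewrite -imset_comp (eq_imset _ (@ord_predK _)) imset_id.
by move=> /eqP E ->; rewrite arcs_in_rot E imset_set1.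
Qed.

Lemma card_arc (x : 'I_m.+3) :
  #|[set I | arcs_in I == [set x]]| = #|[set I | arcs_in I == [set ord_max]]|.
Proof.
have ord0S : ord0 = ordS (ord_max : 'I_m.+3) by apply: val_inj; rewrite /= modnn.
(* The induction walks once around the cycle from [ord_max], whose successor is [ord0]. *)
case: x => k; elim: k => [|k IH] km.
  by rewrite -[RHS]card_arc_rot -ord0S (_ : Ordinal km = ord0) //; apply: val_inj.
rewrite -(IH (ltnW km)) -[RHS]card_arc_rot (_ : Ordinal km = ordS (Ordinal (ltnW km))) //.
by apply: val_inj; rewrite /= modn_small.
Qed.

Lemma sigma1_cycle_arc :
  sigma1 (cycle_graph m.+3) = m.+3 * #|[set I | arcs_in I == [set ord_max]]|.
Proof.
rewrite sigma1E -sum1_card.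
rewrite (eq_bigl (fun I : {set 'I_m.+3} => #|arcs_in I| == 1)); last first.
  by move=> I; rewrite inE card_edges_in_cycle.
rewrite -[X in X * _]card_ord -sum_nat_const.
under [RHS]eq_bigr => x _ do rewrite -(card_arc x) -sum1_card.
under [RHS]eq_bigr => x _ do under eq_bigl => I do rewrite inE.
(* Double counting of pairs of a position [x] and a set [I] whose only arc is [x]: each [I] with one
   arc has exactly one such [x]. *)
rewrite (exchange_big_dep (fun I => #|arcs_in I| == 1)) /=; last first.
  by move=> x I _ /eqP->; rewrite cards1.
apply: eq_bigr => I /cards1P[x ->].
by rewrite (big_pred1 x) // => y; rewrite (inj_eq set1_inj) eq_sym.
Qed.

End Cycle.

(** * Words without consecutive 1s *)

Definition sparse (b : bool) (s : bitseq) := path (fun x y => ~~ (x && y)) b s && last b s.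

(** Here [b] is the letter preceding the word. [nsparse false l] is the Fibonacci number F_l, with
    F_0 = 0 and F_1 = 1. *)
Definition nsparse (b : bool) (l : nat) := #|[set t : l.-tuple bool | sparse b t]|.

(** On the empty word [last] returns the preceding letter, which must then itself be the final 1. *)
Lemma nsparse0 b : nsparse b 0 = b.
Proof.
rewrite /nsparse; case: b.
  rewrite (_ : [set _ | _] = [set [tuple]]) ?cards1 //.
  by apply/setP => t; rewrite tuple0 !inE eqxx.
by apply: eq_card0 => t; rewrite tuple0 !inE.
Qed.

(** Split by the first letter: after a 1 only 0 may follow. *)
Lemma nsparseS b l : nsparse b l.+1 = (if b then 0 else nsparse true l) + nsparse false l.
Proof.
have consI c : injective (fun t : l.-tuple bool => cons_tuple c t).
  by move=> s t /(congr1 val) [] /val_inj.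
pose A c : {set l.+1.-tuple bool} :=
  (fun t : l.-tuple bool => cons_tuple c t) @: [set t : l.-tuple bool | sparse c t].
have cardA c : #|A c| = nsparse c l by rewrite card_imset.
have memA c d (t : l.-tuple bool) : (cons_tuple d t \in A c) = (c == d) && sparse c t.
  apply/imsetP/andP => [[s]|[/eqP<- ct]]; last by exists t; rewrite ?inE.
  by rewrite inE => cs /(congr1 val) [-> /val_inj ->].
have tE (t : l.+1.-tuple bool) : t = cons_tuple (thead t) (behead_tuple t).
  by apply: val_inj; rewrite {1}(tuple_eta t).
have AI : A true :&: A false = set0.
  by apply/setP => t; rewrite (tE t) !inE !memA; case: (thead t); rewrite ?andbF.
have AIc : #|A true :&: A false| = 0 by rewrite AI cards0.
rewrite /nsparse -/(nsparse true l) -/(nsparse false l); case: b.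
  rewrite add0n -cardA; apply: eq_card => t.
  by rewrite (tE t) inE memA /sparse; case: (thead t).
rewrite -!cardA -cardsUI AIc addn0; apply: eq_card => t.
by rewrite (tE t) !inE !memA /sparse; case: (thead t); rewrite ?orbF.
Qed.

Lemma card_wrap_arc m :
  #|[set I : {set 'I_m.+3} | arcs_in I == [set ord_max]]| = nsparse false m.+1.
Proof.
(* The wrap-around arc forces a 1 at position 0, so [I] is given by the [m.+2] letters after it; the
   first of these is 0, which leaves [m.+1] letters. *)
rewrite -[RHS]add0n -(nsparseS true).
pose f (t : m.+2.-tuple bool) : {set 'I_m.+3} := [set i | tnth [tuple of true :: t] i].
have f_inj : injective f.
  move=> s t /setP E; suff : [tuple of true :: s] = [tuple of true :: t].
    by move=> /(congr1 val) [] /val_inj.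
  by apply: eq_from_tnth => i; have := E i; rewrite !inE.
have ordSmax : ordS (ord_max : 'I_m.+3) = ord0 by apply: val_inj; rewrite /= modnn.
rewrite /nsparse -(card_imset _ f_inj); apply: eq_card => I; rewrite inE.
have nthf t k (km : k < m.+3) : (Ordinal km \in f t) = nth false (true :: t) k.
  by rewrite inE (tnth_nth false).
(* The final 1 gives the arc at [ord_max]; the path condition excludes every other arc. *)
have fP t : (arcs_in (f t) == [set ord_max]) = sparse true t.
  have lastf : last true t = (ord_max \in f t).
    by rewrite (_ : ord_max = Ordinal (ltnSn m.+2)) ?nthf ?(last_nth false) ?size_tuple //; exact: val_inj.
  have f0 : ord0 \in f t by rewrite inE.
  apply/eqP/andP => [/setP E|[/(pathP false) P]].
    split; last by have := E ord_max; rewrite lastf !inE eqxx => /andP[].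
    apply/(pathP false) => i; rewrite size_tuple => im.
    have im3 : i < m.+3 by lia.
    have := E (Ordinal im3); rewrite in_set nthf.
    have -> : ordS (Ordinal im3) = Ordinal (im : i.+1 < m.+3).
      by apply: val_inj; rewrite /= modn_small.
    rewrite nthf in_set1 => ->; rewrite -val_eqE /=; lia.
  rewrite lastf => maxf; apply/setP => -[i im3]; rewrite in_set in_set1.
  have [im|im] := ltnP i m.+2.
    have -> : ordS (Ordinal im3) = Ordinal (im : i.+1 < m.+3).
      by apply: val_inj; rewrite /= modn_small.
    rewrite !nthf -val_eqE /=; have := P i; rewrite size_tuple => /(_ im) /negbTE -> /=; lia.
  have -> : Ordinal im3 = ord_max by apply: val_inj => /=; lia.
  by rewrite ordSmax f0 maxf eqxx.
apply/idP/imsetP => [E|[t]]; last by rewrite inE => st ->; rewrite fP.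
pose t : m.+2.-tuple bool := [tuple lift ord0 i \in I | i < m.+2].
have It : I = f t.
  apply/setP => i; rewrite inE; case: (unliftP ord0 i) => [j|] ->.
    by rewrite tnthS tnth_mktuple.
  move/eqP/setP/(_ ord_max): E; rewrite !inE eqxx ordSmax.
  by case/andP.
by exists t; rewrite // inE -fP -It.
Qed.

(** * Binet's formula and the wheel *)

Local Open Scope ring_scope.

Lemma nsparse_binet (R : fieldType) (a b : R) l :
  a ^+ 2 = a + 1 -> b ^+ 2 = b + 1 -> a != b ->
  (nsparse false l)%:R = (a ^+ l - b ^+ l) / (a - b).
Proof.
move=> a2 b2; rewrite -subr_eq0 => ab0.
(* The recurrence has order two, so the induction carries two consecutive values. *)
suff [] : (nsparse false l)%:R = (a ^+ l - b ^+ l) / (a - b) /\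
  (nsparse false l.+1)%:R = (a ^+ l.+1 - b ^+ l.+1) / (a - b) by [].
elim: l => [|l [IH0 IH1]].
  by rewrite !nsparseS !nsparse0 !expr0 !expr1 subrr mul0r divff.
split=> //; rewrite nsparseS nsparseS add0n natrD IH0 IH1.
by rewrite ![_ ^+ l.+2]exprSr ![_ ^+ l.+1]exprSr -!mulrA -!expr2 a2 b2; field.
Qed.

Theorem mainTheorem10 (R : rcfType) (n : nat) (hn : (4 <= n)%N) :
  let alpha : R := (1 + Num.sqrt 5) / 2 in
  let beta : R := (1 - Num.sqrt 5) / 2 in
  (sigma1 (wheel n))%:R =
    (n%:R - 1) * (1 + 1 / Num.sqrt 5 * (alpha ^+ (n - 3) - beta ^+ (n - 3))) :> R.
Proof.
move=> alpha beta; case: n hn => [|[|[|[|m]]]] // _.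
have s2 : Num.sqrt 5 ^+ 2 = 5 :> R by rewrite sqr_sqrtr ?ler0n.
have s0 : Num.sqrt 5 != 0 :> R by apply: lt0r_neq0; rewrite sqrtr_gt0 ltr0n.
have a2 : alpha ^+ 2 = alpha + 1 by rewrite /alpha; field: s2.
have b2 : beta ^+ 2 = beta + 1 by rewrite /beta; field: s2.
have ab : alpha - beta = Num.sqrt 5 by rewrite /alpha /beta; field.
have neq_ab : alpha != beta by rewrite -subr_eq0 ab.
(* With [n = m.+4] the rim has [m.+3] vertices, and the Fibonacci index [m.+1] is [n - 3]. *)
rewrite /wheel sigma1_cone sigma1_cycle_arc card_wrap_arc card_ord.
rewrite -mulnS natrM -[m.+4%:R]natr1 addrK; congr (_ * _).
rewrite -add1n natrD (nsparse_binet m.+1 a2 b2 neq_ab) ab.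
by rewrite !subSS subn0; field.
Qed.
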